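(* Let $U,V$ be nonlocal vertex algebras and $R(x)$ a twisting operator for $(U,V)$. Let $K$ be a nonlocal vertex algebra and let $\psi_1:U\to K$, $\psi_2:V\to K$ be homomorphisms of nonlocal vertex algebras such that for all $u\in U$, $v\in V$, $$Y(\psi_1(u),x)\psi_2(v)\in K[[x]],\qquad Y(\psi_2(v),x)\psi_1(u)=e^{x\mathcal D}\sum_{i=1}^r f_i(-x)\,Y(\psi_1(u_i),-x)\psi_2(v_i),$$ where $R(x)(v\otimes u)=\sum_{i=1}^r u_i\otimes v_i\otimes f_i(x)$ and $\mathcal D$ is the $\mathcal D$-operator of $K$. Then the linear map $\psi:U\otimes_RV\to K$ defined by $\psi(u\otimes v)=\psi_1(u)_{-1}\psi_2(v)$ is a homomorphism of nonlocal vertex algebras extending $\psi_1$ and $\psi_2$ (i.e. $\psi(u\otimes\mathbf 1)=\psi_1(u)$, $\psi(\mathbf 1\otimes v)=\psi_2(v)$), and it is the unique such homomorphism.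
   Context: All vector spaces are over $\mathbb{C}$. A nonlocal vertex algebra is a vector space $V$ with a linear map $Y(\cdot,x):V\to \mathrm{Hom}(V,V((x)))$, $v\mapsto Y(v,x)=\sum_{n\in\mathbb Z}v_nx^{-n-1}$, and a vector $\mathbf 1\in V$ such that for all $v$: $Y(\mathbf 1,x)v=v$, $Y(v,x)\mathbf 1\in V[[x]]$, $\lim_{x\to0}Y(v,x)\mathbf 1=v$; and for all $u,v,w$ there is $k\ge0$ with $(x_0+x_2)^kY(u,x_0+x_2)Y(v,x_2)w=(x_0+x_2)^kY(Y(u,x_0)v,x_2)w$. Homomorphisms preserve vacuum and vertex operators. Write $Y(x)(u\otimes v)=Y(u,x)v$; $\mathcal Dv=v_{-2}\mathbf 1$. Conventions: $f(x_1\pm x_2)$ for $f\in\mathbb C((x))$ is expanded in nonnegative powers of the second variable; $T^{ij}$ denotes $T$ acting on tensor factors $i,j$; maps are extended linearly over scalar series. Twisting operator for $(U,V)$: a linear map $R(x):V\otimes U\to U\otimes V\otimes\mathbb C((x))$ such that $R(x)(v\otimes\mathbf 1)=\mathbf 1\otimes v$, $R(x)(\mathbf 1\otimes u)=u\otimes\mathbf 1$, $R(x_1)(1\otimes Y(x_2))=(Y(x_2)\otimes1)R^{23}(x_1)R^{12}(x_1+x_2)$ on $V\otimes U\otimes U$, and $R(x_1)(Y(x_2)\otimes 1)=(1\otimes Y(x_2))R^{12}(x_1-x_2)R^{23}(x_1)$ on $V\otimes V\otimes U$. Twisted tensor product $U\otimes_RV$: the nonlocal vertex algebra on $U\otimes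 V$ with vacuum $\mathbf 1\otimes\mathbf 1$ and $Y_R(u\otimes v,x)(u'\otimes v')=\sum_i f_i(-x)Y(u,x)u'_i\otimes Y(v_i,x)v'$ where $R(x)(v\otimes u')=\sum_i u'_i\otimes v_i\otimes f_i(x)$. *)

(* Defs.v *)
From HB Require Import structures.
From mathcomp Require Import all_boot all_order all_algebra.
From mathcomp Require Import complex reals.
From Stdlib Require Import ClassicalEpsilon.

Set Implicit Arguments.
Unset Strict Implicit.
Unset Printing Implicit Defensive.
Import Order.TTheory GRing.Theory Num.Theory.
Local Open Scope ring_scope.

(* Formal series conventions.  A formal series in one variable x with       *)
(* coefficients in W is represented by its coefficient function int -> W    *)
(* (coefficient of x^m).  Vertex operators are represented by their modes:  *)
(* Y u v n = u_n v, so that Y(u,x)v = \sum_n (Y u v n) x^{-n-1}.            *)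

(* Sum of a finitely supported family indexed by int (0 if the family is not
   finitely supported; only used on finitely supported families). *)
Definition fsum (W : nmodType) (G : int -> W) : W :=
  match excluded_middle_informative
          (exists N : nat, forall n : int, (N <= absz n)%N -> G n = 0) with
  | left H =>
      let N := proj1_sig (constructive_indefinite_description _ H) in
      \sum_(i < (N.*2).+1) G (i%:Z - N%:Z)
  | right _ => 0
  end.

Definition sgn (F : pzRingType) (p : int) : F := if odd (absz p) then -1 else 1.

Definition gbin (F : fieldType) (N : int) (j : nat) : F :=
  (\prod_(i < j) ((N - i%:Z)%:~R : F)) / (j`!)%:R.

Section Defs.
Variable F : fieldType.

(* coefficient series of Y(a,x)b : coefficient of x^m is a_{-m-1} b *)
Definition Yser (V : lmodType F) (Y : V -> V -> int -> V) (a b : V) : int -> V :=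
  fun m => Y a b (- m - 1).

(* g(x) |-> g(-x) *)
Definition sneg (W : lmodType F) (g : int -> W) : int -> W :=
  fun m => sgn F m *: g m.

Definition smul (W : lmodType F) (f : int -> F) (g : int -> W) : int -> W :=
  fun m => fsum (fun p => f p *: g (m - p)).

Definition expD (W : lmodType F) (D : W -> W) (g : int -> W) : int -> W :=
  fun m => fsum (fun j : int => if (0 <= j)%R
                 then ((absz j)`!%:R)^-1 *: iter (absz j) D (g (m - j)) else 0).

Definition linmap (V W : lmodType F) (f : V -> W) : Prop :=
  forall (a : F) (x y : V), f (a *: x + y) = a *: f x + f y.

Definition bilin (U V W : lmodType F) (b : U -> V -> W) : Prop :=
  (forall v, linmap (fun u => b u v)) /\ (forall u, linmap (b u)).

Definition is_nva (V : lmodType F) (Y : V -> V -> int -> V) (one : V) : Prop :=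
  [/\ (forall n, bilin (fun u v => Y u v n)),
      (forall u v, exists N : int, forall n, N <= n -> Y u v n = 0),
      (forall v n, Y one v n = if n == -1 then v else 0),
      (forall v, (forall n, 0 <= n -> Y v one n = 0) /\ Y v one (-1) = v) &
      (* weak associativity: coefficient of x0^a x2^b of
           (x0+x2)^k Y(u,x0+x2)Y(v,x2)w = (x0+x2)^k Y(Y(u,x0)v,x2)w,
         binomial expansions in nonnegative powers of x2 *)
      (forall u v w, exists k : nat, forall a b : int,
         fsum (fun j : int => if (0 <= j)%R
                 then gbin F (a + j) (absz j) *: Y u (Y v w (j - b - 1)) (k%:Z - 1 - j - a)
                 else 0)
         = \sum_(i < k.+1) ('C(k, i))%:R *: Y (Y u v (k%:Z - i%:Z - a - 1)) w (i%:Z - b - 1))].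

Definition is_nva_hom (V1 V2 : lmodType F) (Y1 : V1 -> V1 -> int -> V1) (one1 : V1)
  (Y2 : V2 -> V2 -> int -> V2) (one2 : V2) (f : V1 -> V2) : Prop :=
  [/\ linmap f, f one1 = one2 & forall u v n, f (Y1 u v n) = Y2 (f u) (f v) n].

Definition Dop (V : lmodType F) (Y : V -> V -> int -> V) (one : V) : V -> V :=
  fun v => Y v one (-2).

(* A twisting operator R(x) : V (x) U -> U (x) V (x) C((x)) is given by
   R v u = [:: (u_i, v_i, f_i)]  meaning  R(x)(v (x) u) = \sum_i u_i (x) v_i (x) f_i(x).
   Equalities of elements of (series with coefficients in) U (x) V are tested
   against all bilinear maps beta : U -> V -> W (universal property). *)
Section Twist.
Variables (U V : lmodType F).
Implicit Types (R : V -> U -> seq (U * V * (int -> F))).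

Definition ev (W : lmodType F) (beta : U -> V -> W) (s : seq (U * V * (int -> F))) (m : int) : W :=
  \sum_(t <- s) t.2 m *: beta t.1.1 t.1.2.

(* coefficient of x1^p x2^j in f(x1 + x2), expanded in nonneg powers of x2 *)
Definition plus_exp (f : int -> F) (p j : int) : F :=
  if (0 <= j)%R then gbin F (p + j) (absz j) * f (p + j) else 0.
(* coefficient of x1^p x2^j in f(x1 - x2), expanded in nonneg powers of x2 *)
Definition minus_exp (f : int -> F) (p j : int) : F :=
  if (0 <= j)%R then gbin F (p + j) (absz j) * sgn F j * f (p + j) else 0.

Definition is_twisting (YU : U -> U -> int -> U) (oneU : U)
  (YV : V -> V -> int -> V) (oneV : V) R : Prop :=
  (forall v u t, List.In t (R v u) -> exists N : int, forall n, n < N -> t.2 n = 0) /\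
  forall (W : lmodType F) (beta : U -> V -> W), bilin beta ->
  [/\
      (forall a v1 v2 u m, ev beta (R (a *: v1 + v2) u) m
                           = a *: ev beta (R v1 u) m + ev beta (R v2 u) m),
      (forall a v u1 u2 m, ev beta (R v (a *: u1 + u2)) m
                           = a *: ev beta (R v u1) m + ev beta (R v u2) m),
      (forall v m, ev beta (R v oneU) m = if m == 0 then beta oneU v else 0),
      (forall u m, ev beta (R oneV u) m = if m == 0 then beta u oneV else 0) /\
      (* R(x1)(1 (x) Y(x2)) = (Y(x2) (x) 1) R^{23}(x1) R^{12}(x1+x2)  on V (x) U (x) U,
         coefficient of x1^m x2^k, applied to v (x) u (x) u' *)
      (forall v u u' m k,
         ev beta (R v (YU u u' (- k - 1))) m
         = \sum_(t <- R v u) \sum_(t' <- R t.1.2 u')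
             fsum (fun q => fsum (fun j =>
               (plus_exp t.2 (m - q) j * t'.2 q)
                 *: beta (Yser YU t.1.1 t'.1.1 (k - j)) t'.1.2))) &
      (* R(x1)(Y(x2) (x) 1) = (1 (x) Y(x2)) R^{12}(x1-x2) R^{23}(x1)  on V (x) V (x) U,
         coefficient of x1^m x2^k, applied to v (x) v' (x) u *)
      (forall v v' u m k,
         ev beta (R (YV v v' (- k - 1)) u) m
         = \sum_(t <- R v' u) \sum_(t' <- R v t.1.1)
             fsum (fun q => fsum (fun j =>
               (minus_exp t'.2 (m - q) j * t.2 q)
                 *: beta t'.1.1 (Yser YV t'.1.2 t.1.2 (k - j)))))].

(* For phi : U -> V -> W bilinear (= a linear map on U (x) V), the x^m coefficient of
   phi(Y_R(u (x) v, x)(u' (x) v')) where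
   Y_R(u (x) v,x)(u' (x) v') = \sum_i f_i(-x) Y(u,x)u'_i (x) Y(v_i,x)v',
   R(x)(v (x) u') = \sum_i u'_i (x) v_i (x) f_i(x). *)
Definition twY (YU : U -> U -> int -> U) (YV : V -> V -> int -> V) R
  (W : lmodType F) (phi : U -> V -> W) (u : U) (v : V) (u' : U) (v' : V) (m : int) : W :=
  \sum_(t <- R v u')
     fsum (fun p => (sgn F p * t.2 p) *:
       fsum (fun r => phi (Yser YU u t.1.1 r) (Yser YV t.1.2 v' (m - p - r)))).

(* phi (a linear map U (x)_R V -> K, given as a bilinear map U -> V -> K) is a
   homomorphism of nonlocal vertex algebras U (x)_R V -> K. *)
Definition is_tt_hom (YU : U -> U -> int -> U) (oneU : U)
  (YV : V -> V -> int -> V) (oneV : V) R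
  (K : lmodType F) (YK : K -> K -> int -> K) (oneK : K) (phi : U -> V -> K) : Prop :=
  [/\ bilin phi, phi oneU oneV = oneK &
      forall u v u' v' m,
        twY YU YV R phi u v u' v' m = Yser YK (phi u v) (phi u' v') m].

End Twist.
End Defs.

Notation Cx R := (R[i])%type.

(* Main.v *)
Require Import Defs.
From HB Require Import structures.
From mathcomp Require Import all_boot all_order all_algebra.
From mathcomp Require Import complex reals.
From mathcomp Require Import zify ring.
From Stdlib Require Import ClassicalEpsilon FunctionalExtensionality.
Import Order.TTheory GRing.Theory Num.Theory.
Local Open Scope ring_scope.

Set Implicit Arguments.
Unset Strict Implicit.
Unset Printing Implicit Defensive.

(* Write [psi (u, v) = psi1(u)_{-1} psi2(v)], the constant term of the regular series
   [Y(psi1 u, x) psi2 v].  Three product formulas give the homomorphism property.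
   - Since [Y(psi1 u, x0) psi2 v] is regular, the powers of [x0 + x2] in weak
     associativity can be cancelled once both sides lie in a ring of series with no
     negative powers of [x0]; hence [Y(psi(u, v), x) w] is the diagonal of
     [Y(psi1 u, x1) Y(psi2 v, x) w].
   - The same cancellation, now with no negative powers of [x2], gives
     [Y(psi1 u, x) psi(u', v') = psi(Y(u, x) u', v')].
   - The commutation hypothesis and [Y(e^{x0 D} c, x) = Y(c, x + x0)] give
     [Y(Y(psi2 v, x0) psi1 u', x) psi2 v' = \sum_i f_i(-x0) P_i(x, x + x0)], where
     [P_i(x1, x2) = Y(psi1 u'_i, x1) Y(psi2 v_i, x2) psi2 v'].  Weak associativity turns
     the left side into [Y(psi2 v, x0 + x) Y(psi1 u', x) psi2 v'], both expansions being
     identified by clearing powers of [x0 + x]; the constant term in [x] is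
     [Y(psi2 v, x0) psi(u', v') = \sum_i f_i(-x0) psi(u'_i, Y(v_i, x0) v')].
   Uniqueness is the constant term of [Y(u (x) 1, x)(1 (x) v)]. *)

(** * Finitely supported sums *)

(** This is the case condition in [fsum]. Outside it [fsum] takes the default value 0, so additivity
    and reindexing require it. *)
Definition finsupp (W : nmodType) (G : int -> W) : Prop :=
  exists N : nat, forall n : int, (N <= absz n)%N -> G n = 0.

Section Fsum.
Variable W : nmodType.
Implicit Types G H : int -> W.

Lemma big_supp G (s1 s2 : seq int) : uniq s1 -> uniq s2 ->
  (forall n, n \notin s1 -> G n = 0) -> (forall n, n \notin s2 -> G n = 0) ->
  \sum_(n <- s1) G n = \sum_(n <- s2) G n.
Proof.
move=> u1 u2 h1 h2.
have filt s : \sum_(n <- s) G n = \sum_(n <- [seq n <- s | G n != 0]) G n.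
  rewrite big_filter [RHS]big_mkcond /=; apply: eq_bigr => n _.
  by case: eqP.
rewrite (filt s1) (filt s2); apply: perm_big.
apply: uniq_perm; rewrite ?filter_uniq // => n; rewrite !mem_filter.
case: (eqVneq (G n) 0) => //= Gn.
case: (boolP (n \in s1)) (h1 n) => [_ _|_ /(_ isT) /eqP]; last by rewrite (negPf Gn).
by case: (boolP (n \in s2)) (h2 n) => // _ /(_ isT) /eqP; rewrite (negPf Gn).
Qed.

Definition window (N : nat) : seq int := [seq i%:Z - N%:Z | i <- iota 0 (N.*2).+1].

Lemma window_uniq N : uniq (window N).
Proof. by rewrite map_inj_uniq ?iota_uniq // => i j /addIr []. Qed.

Lemma notin_window N (n : int) : n \notin window N -> (N <= absz n)%N.
Proof.
move=> /negP hn; rewrite leqNgt; apply/negP => h; apply: hn.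
apply/mapP; exists (absz (n + N%:Z)).
  by rewrite mem_iota; lia.
lia.
Qed.

Lemma finsupp_seq G (s : seq int) : (forall n, n \notin s -> G n = 0) -> finsupp G.
Proof.
move=> h; exists (\sum_(n <- s) absz n).+1 => n hn; apply: h; apply/negP => ns.
by move: hn; rewrite (big_rem n) //=; lia.
Qed.

(** The bound inside [fsum] comes from a choice operator and is opaque; by [big_supp] any
    duplicate-free list covering the support gives the same value. *)
Lemma fsum_seq G (s : seq int) : uniq s -> (forall n, n \notin s -> G n = 0) ->
  fsum G = \sum_(n <- s) G n.
Proof.
move=> us hs; rewrite /fsum.
case: excluded_middle_informative => [H|[]]; last exact: (finsupp_seq hs).
case: constructive_indefinite_description => N /= hN.
rewrite -(big_mkord xpredT (fun i => G (i%:Z - N%:Z))) /index_iota subn0.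
rewrite -(big_map (fun i : nat => i%:Z - N%:Z) xpredT G).
apply: big_supp => //; first exact: window_uniq.
by move=> n /notin_window; apply: hN.
Qed.

Lemma finsuppP G : finsupp G ->
  exists2 s : seq int, uniq s & forall n, n \notin s -> G n = 0.
Proof.
case=> N hN; exists (window N); first exact: window_uniq.
by move=> n /notin_window; apply: hN.
Qed.

Lemma finsupp_itv (lo hi : int) G :
  (forall n, n < lo \/ hi < n -> G n = 0) -> finsupp G.
Proof. by move=> h; exists (absz lo + absz hi).+1 => n hn; apply: h; lia. Qed.

Lemma eq_fsum G H : (forall n, G n = H n) -> fsum G = fsum H.
Proof. by move=> /functional_extensionality ->. Qed.

Lemma fsum0 G : (forall n, G n = 0) -> fsum G = 0.
Proof. by move=> h; rewrite (@fsum_seq _ [::]) ?big_nil. Qed.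

Lemma fsum1 G (c : int) : (forall n, n != c -> G n = 0) -> fsum G = G c.
Proof.
by move=> h; rewrite (@fsum_seq _ [:: c]) ?big_seq1 // => n; rewrite inE => /h.
Qed.

Lemma fsum_sum (I : Type) (s : seq I) (G : I -> int -> W) :
  (forall i, List.In i s -> finsupp (G i)) ->
  finsupp (fun n => \sum_(i <- s) G i n) /\
  fsum (fun n => \sum_(i <- s) G i n) = \sum_(i <- s) fsum (G i).
Proof.
elim: s => [|i s IH] h.
  by split; [exists 0%N => n _|rewrite fsum0 ?big_nil // => n]; rewrite big_nil.
have [[N1 h1] e] := IH (fun j hj => h j (or_intror hj)).
have [N2 h2] := h i (or_introl erefl).
have hN n : (maxn N1 N2 <= absz n)%N -> \sum_(j <- s) G j n = 0 /\ G i n = 0.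
  by move=> hn; split; [apply: h1|apply: h2]; lia.
have nw (n : int) : n \notin window (maxn N1 N2) -> (\sum_(j <- s) G j n = 0) /\ (G i n = 0).
  by move=> /notin_window /hN.
split.
  by exists (maxn N1 N2) => n /hN [e1 e2]; rewrite big_cons e1 e2 addr0.
rewrite big_cons -e.
rewrite (@fsum_seq _ (window (maxn N1 N2))) ?window_uniq //; last first.
  by move=> n /nw[e1 e2]; rewrite big_cons e1 e2 addr0.
rewrite (@fsum_seq (G i) (window (maxn N1 N2))) ?window_uniq //; last by move=> n /nw[].
rewrite (@fsum_seq (fun n => \sum_(j <- s) G j n) (window (maxn N1 N2))) ?window_uniq //;
  last by move=> n /nw[].
by rewrite -big_split; apply: eq_bigr => n _; rewrite big_cons.
Qed.

Lemma fsumD G H : finsupp G -> finsupp H ->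
  fsum (fun n => G n + H n) = fsum G + fsum H.
Proof.
move=> hG hH.
have [] := @fsum_sum bool [:: true; false] (fun b => if b then G else H).
  by move=> [].
move=> _; rewrite !big_cons big_nil addr0 => <-; apply: eq_fsum => n.
by rewrite !big_cons big_nil addr0.
Qed.

Lemma fsum_shift G (c : int) : finsupp G -> fsum (fun n => G (n + c)) = fsum G.
Proof.
move=> /finsuppP[s us hs]; rewrite (fsum_seq us hs).
rewrite (@fsum_seq _ [seq n - c | n <- s]).
- by rewrite big_map; apply: eq_bigr => n _; rewrite subrK.
- by rewrite map_inj_uniq // => x y /addIr.
- move=> n hn; apply: hs; apply: contra hn => hn; apply/mapP; exists (n + c) => //.
  by rewrite addrK.
Qed.

Lemma fsum_refl G (c : int) : finsupp G -> fsum (fun n => G (c - n)) = fsum G.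
Proof.
move=> /finsuppP[s us hs]; rewrite (fsum_seq us hs).
rewrite (@fsum_seq _ [seq c - n | n <- s]).
- by rewrite big_map; apply: eq_bigr => n _; rewrite subKr.
- by rewrite map_inj_uniq // => x y /addrI/oppr_inj.
- move=> n hn; apply: hs; apply: contra hn => hn; apply/mapP; exists (c - n) => //.
  by rewrite subKr.
Qed.

Lemma exchange_fsum (G : int -> int -> W) (lo1 hi1 lo2 hi2 : int) :
  (forall n m, [\/ n < lo1, hi1 < n, m < lo2 | hi2 < m] -> G n m = 0) ->
  fsum (fun n => fsum (G n)) = fsum (fun m => fsum (fun n => G n m)).
Proof.
move=> h; pose N := (absz lo1 + absz hi1 + absz lo2 + absz hi2).+1.
have hl (n m : int) : n \notin window N -> G n m = 0.
  move=> /notin_window hn; apply: h.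
  by case: (ltP n lo1) => ?; [apply: Or41|apply: Or42; lia].
have hr (n m : int) : m \notin window N -> G n m = 0.
  move=> /notin_window hn; apply: h.
  by case: (ltP m lo2) => ?; [apply: Or43|apply: Or44; lia].
have u := window_uniq N.
rewrite (fsum_seq u); last by move=> n hn; apply: fsum0 => m; apply: hl.
rewrite (fsum_seq u); last by move=> m hm; apply: fsum0 => n; apply: hr.
transitivity (\sum_(n <- window N) \sum_(m <- window N) G n m).
  by apply: eq_bigr => n _; rewrite (fsum_seq u) // => m; apply: hr.
rewrite exchange_big; apply: eq_bigr => m _; rewrite (fsum_seq u) // => n; apply: hl.
Qed.

End Fsum.

(** * Linear maps and finitely supported sums *)

Section Linear.
Variables (F : fieldType) (V W : lmodType F).
Variables (f : V -> W) (lf : linmap f).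

Lemma linmapD x y : f (x + y) = f x + f y.
Proof. by rewrite -[x]scale1r lf !scale1r. Qed.

Lemma linmap0 : f 0 = 0.
Proof. by apply: (@addrI _ (f 0)); rewrite -linmapD !addr0. Qed.

Lemma linmapZ a x : f (a *: x) = a *: f x.
Proof. by rewrite -[a *: x]addr0 lf linmap0 addr0. Qed.

Lemma linmap_sum (I : Type) (s : seq I) (G : I -> V) :
  f (\sum_(i <- s) G i) = \sum_(i <- s) f (G i).
Proof. by elim/big_rec2: _ => [|i y1 y2 _ <-]; rewrite ?linmap0 ?linmapD. Qed.

Lemma linmap_fsum (G : int -> V) : finsupp G -> f (fsum G) = fsum (fun n => f (G n)).
Proof.
move=> /finsuppP[s us hs]; rewrite (fsum_seq us hs) linmap_sum (fsum_seq us) //.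
by move=> n /hs ->; rewrite linmap0.
Qed.
End Linear.

Lemma fsumZ (F : fieldType) (W : lmodType F) (c : F) (G : int -> W) :
  finsupp G -> fsum (fun n => c *: G n) = c *: fsum G.
Proof.
move=> hG; rewrite (@linmap_fsum _ _ _ (fun x => c *: x)) // => a x y.
by rewrite scalerDr !scalerA mulrC.
Qed.

(** * Expansions of powers of x0 + x2 *)

Section Binomial.
Variable F : numFieldType.

Lemma gbin0 (p : int) : gbin F p 0 = 1.
Proof. by rewrite /gbin big_ord0 fact0 divr1. Qed.

Lemma gbinS (p : int) (j : nat) :
  gbin F p j.+1 = gbin F (p - 1) j.+1 + gbin F (p - 1) j.
Proof.
rewrite /gbin big_ord_recl big_ord_recr /=.
under eq_bigr => i _.
  rewrite (_ : p - (bump 0 i)%:Z = p - 1 - i%:Z); last by rewrite /bump /=; lia.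
  over.
set P := \prod_(i < j) _.
have h1 : (j`!%:R : F) != 0 by rewrite pnatr_eq0 -lt0n fact_gt0.
have h2 : (j.+1%:R : F) != 0 by rewrite pnatr_eq0.
rewrite factS natrM subr0 !intrD !mulrNz.
rewrite -[j.+1%:R]/(1 + j)%:R natrD -[j%:~R]/(j%:R) in h2 *.
by field; rewrite h1 h2.
Qed.

Lemma gbin_nat (n j : nat) : gbin F n%:Z j = 'C(n, j)%:R.
Proof.
elim: n j => [|n IH] [|j]; rewrite ?gbin0 ?bin0 //.
  by rewrite /gbin big_ord_recl /= subrr mul0r mul0r bin0n.
by rewrite gbinS (_ : n.+1%:Z - 1 = n); [rewrite !IH binS natrD|lia].
Qed.

(* The coefficients of [x0^a x2^j] in [(x0 + x2)^(a + j)], expanded in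
   nonnegative powers of [x2] ([cR]) or of [x0] ([cL]). *)
Definition cR (a j : int) : F := if 0 <= j then gbin F (a + j) (absz j) else 0.
Definition cL (a j : int) : F := cR j a.

Lemma cR_lt0 a j : j < 0 -> cR a j = 0.
Proof. by rewrite /cR; case: ifP => //; lia. Qed.

Lemma cR0 a : cR a 0 = 1.
Proof. by rewrite /cR /= gbin0. Qed.

(** Compare coefficients of [x0^a x2^j] in [(x0 + x2)^(a+j) = (x0 + x2) (x0 + x2)^(a+j-1)]. *)
Lemma cR_pascal a j : cR a j = cR (a - 1) j + cR a (j - 1).
Proof.
rewrite /cR; case: (ltgtP 0 j) => [j0|j0|<-] /=.
- have -> : (0 <= j - 1) by lia.
  case: j j0 => // -[//|j] _.
  rewrite (_ : absz (j.+1%:Z - 1) = j); last by lia.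
  rewrite (_ : absz j.+1%:Z = j.+1); last by lia.
  by rewrite gbinS; congr (gbin F _ _ + gbin F _ _); lia.
- by case: ifP; [lia|rewrite addr0].
- by rewrite !gbin0 addr0.
Qed.

Lemma cL_pascal a j : cL a j = cL (a - 1) j + cL a (j - 1).
Proof. by rewrite /cL cR_pascal addrC. Qed.

Lemma cR_nat (a j : int) (n : nat) : a + j = n%:Z ->
  cR a j = if 0 <= j then 'C(n, absz j)%:R else 0.
Proof. by rewrite /cR => ->; rewrite gbin_nat. Qed.

(** A nonnegative power of [x0 + x2] is a polynomial, so both expansions coincide, by symmetry of
    binomial coefficients. *)
Lemma cLR (a j : int) : 0 <= a + j -> cL a j = cR a j.
Proof.
move=> h; have e : a + j = (absz (a + j))%:Z by lia.
rewrite /cL (cR_nat e) (@cR_nat _ _ (absz (a + j))); last by lia.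
case: (lerP 0 a) => a0; case: (lerP 0 j) => j0 //.
- by rewrite -bin_sub; [congr ('C(_, _)%:R); lia|lia].
- by rewrite bin_small //; lia.
- by rewrite bin_small //; lia.
Qed.

Lemma sgnD (p q : int) : sgn F (p + q) = sgn F p * sgn F q.
Proof.
rewrite /sgn (_ : odd (absz (p + q)) = odd (absz p) (+) odd (absz q)); last by lia.
by case: odd; case: odd; rewrite /= ?mulrNN ?mulr1 ?mul1r.
Qed.

Lemma sgnN (p : int) : sgn F (- p) = sgn F p.
Proof. by rewrite /sgn abszN. Qed.

Lemma sgn_sq (p : int) : sgn F p * sgn F p = 1.
Proof. by rewrite /sgn; case: odd; rewrite ?mulrNN mulr1. Qed.

End Binomial.

(* A double series [E] stands for [\sum E a b x0^a x2^b]; [Tmul] multiplies it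
   by [x0 + x2]. *)
Section Tmul.
Variables (W : zmodType).
Implicit Types E : int -> int -> W.

Definition Tmul E : int -> int -> W := fun a b => E (a - 1) b + E a (b - 1).

Lemma iter_Tmul_lt0l k E : (forall a b, a < 0 -> E a b = 0) ->
  forall a b, a < 0 -> iter k Tmul E a b = 0.
Proof.
by move=> h; elim: k => //= k IH a b a0; rewrite /Tmul !IH ?addr0 //; lia.
Qed.

(** On all double series [Tmul] has a kernel, for instance the sum of [(-1)^a x0^a x2^(-a-1)].
    Without negative powers of [x0], the coefficient at [(a, b + 1)] recovers [E a b] from
    [E (a - 1) (b + 1)], by induction on [a]. *)
Lemma iter_Tmul_injl k E1 E2 :
  (forall a b, a < 0 -> E1 a b = 0) -> (forall a b, a < 0 -> E2 a b = 0) ->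
  iter k Tmul E1 = iter k Tmul E2 -> forall a b, E1 a b = E2 a b.
Proof.
move=> h1 h2; elim: k => [/= -> //|k IH] /= e; apply: IH.
have {}h1 := iter_Tmul_lt0l k h1; have {}h2 := iter_Tmul_lt0l k h2.
move: (iter k Tmul E1) (iter k Tmul E2) e h1 h2 => {}E1 {}E2 e h1 h2.
apply: functional_extensionality => a; apply: functional_extensionality => b.
case: (ltrP a 0) => a0; first by rewrite h1 ?h2.
have {a0} -> : a = (absz a)%:Z by lia.
elim: (absz a) b => [|n IH] b;
  have := congr1 (fun f => f _ (b + 1)) e; rewrite /Tmul => {e}.
  by move=> /(_ 0); rewrite !addrK h1 // h2 // !add0r.
move=> /(_ n.+1%:Z); rewrite !addrK (_ : n.+1%:Z - 1 = n) ?IH; last by lia.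
exact: addrI.
Qed.

Lemma iter_Tmul_swap k E a b :
  iter k Tmul (fun x y => E y x) a b = iter k Tmul E b a.
Proof. by elim: k a b => //= k IH a b; rewrite /Tmul !IH addrC. Qed.

Lemma iter_Tmul_injr k E1 E2 :
  (forall a b, b < 0 -> E1 a b = 0) -> (forall a b, b < 0 -> E2 a b = 0) ->
  iter k Tmul E1 = iter k Tmul E2 -> forall a b, E1 a b = E2 a b.
Proof.
move=> h1 h2 e a b.
apply: (@iter_Tmul_injl k (fun x y => E1 y x) (fun x y => E2 y x)).
- by move=> x y; apply: h1.
- by move=> x y; apply: h2.
by apply: functional_extensionality => x; apply: functional_extensionality => y;
  rewrite (iter_Tmul_swap k E1) (iter_Tmul_swap k E2) e.
Qed.
End Tmul.

Section Expansion.
Variables (F : numFieldType) (W : lmodType F).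
Implicit Types (E P : int -> int -> W) (c : int -> int -> F).

Lemma iter_TmulE k E a b :
  iter k (@Tmul W) E a b =
  \sum_(i < k.+1) 'C(k, i)%:R *: E (a - k%:Z + i%:Z) (b - i%:Z).
Proof.
elim: k a b => [|k IH] a b.
  by rewrite big_ord1 /= scale1r subr0 addr0 subr0.
rewrite iterS /Tmul !IH [RHS]big_ord_recl [X in X + _ = _]big_ord_recl !bin0 !scale1r.
rewrite -[LHS]addrA; congr (_ + _); first by congr (E _ _) => /=; lia.
under [in RHS]eq_bigr => i _ do rewrite lift0 binS natrD scalerDl.
rewrite big_split /=; congr (_ + _).
  rewrite [RHS]big_ord_recr /= bin_small // scale0r addr0.
  by apply: eq_bigr => i _; rewrite /= /bump /= ?add1n; congr (_ *: E _ _); lia.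
by apply: eq_bigr => i _; congr (_ *: E _ _); lia.
Qed.

(* If [P q n] is the coefficient of [x1^q x2^n] in [P(x1, x2)], this is
   [P(x0 + x2, x2)], with powers of [x0 + x2] expanded according to [c]. *)
Definition subst_sum c P : int -> int -> W :=
  fun a b => fsum (fun j => c a j *: P (a + j) (b - j)).

Definition xshift k P : int -> int -> W := fun q n => P (q - k) n.

(** Under [x1 = x0 + x2], multiplying by [(x0 + x2)^k] amounts to multiplying [P] by [x1^k], which
    is [xshift k]. The Pascal rule is all that this uses of [c], so it covers both expansions. *)
Lemma iter_Tmul_subst c P k :
  (forall a j, c a j = c (a - 1) j + c a (j - 1)) ->
  (forall m a b, finsupp (fun j => c a j *: xshift m P (a + j) (b - j))) ->
  iter k (@Tmul W) (subst_sum c P) = subst_sum c (xshift k%:Z P).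
Proof.
move=> hc hf.
apply: functional_extensionality => a; apply: functional_extensionality => b.
elim: k a b => [|k IH] a b.
  by apply: eq_fsum => j; rewrite /xshift subr0.
rewrite iterS /Tmul !IH /subst_sum.
have e1 j : c (a - 1) j *: xshift k P (a - 1 + j) (b - j) =
            c (a - 1) j *: xshift k.+1 P (a + j) (b - j).
  by rewrite /xshift; congr (_ *: P _ _); lia.
have e2 j : c a (j - 1) *: xshift k P (a + (j - 1)) (b - 1 - (j - 1)) =
            c a (j - 1) *: xshift k.+1 P (a + j) (b - j).
  by rewrite /xshift; congr (_ *: P _ _); lia.
have f1 := hf k (a - 1) b; have f2 := hf k a (b - 1).
rewrite -[X in _ + X](fsum_shift (-1)) // (eq_fsum e1) (eq_fsum e2) -fsumD.
- by apply: eq_fsum => j; rewrite (hc a j) scalerDl.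
- by case: f1 => N hN; exists N => n hn; rewrite -e1 hN.
- case: f2 => N hN; exists N.+1 => n hn; rewrite -e2 hN //; lia.
Qed.
End Expansion.

(** * Comparison of the two expansions and the skew substitution *)

Section SubstSum.
Variables (F : numFieldType) (W : lmodType F).
Implicit Types (P : int -> int -> W).

Lemma finsupp_subst_cR P n0 : (forall q n, n < n0 -> P q n = 0) ->
  forall m a b, finsupp (fun j => cR F a j *: xshift m P (a + j) (b - j)).
Proof.
move=> h m a b; apply: (@finsupp_itv _ 0 (b - n0)) => j [j0|j0].
  by rewrite cR_lt0 ?scale0r.
by rewrite /xshift h ?scaler0 //; lia.
Qed.

Lemma finsupp_subst_cL P q0 n0 : (forall q n, q < q0 \/ n < n0 -> P q n = 0) ->
  forall m a b, finsupp (fun j => cL F a j *: xshift m P (a + j) (b - j)).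
Proof.
move=> h m a b; apply: (@finsupp_itv _ (q0 + m - a) (b - n0)) => j hj.
by rewrite /xshift h ?scaler0 //; lia.
Qed.

(* A large power of [x0 + x2] clears the denominators, after which both
   expansions agree. *)
Lemma iter_Tmul_cLR P q0 n0 k : (forall q n, q < q0 \/ n < n0 -> P q n = 0) ->
  (absz q0 <= k)%N ->
  iter k (@Tmul W) (subst_sum (cL F) P) = iter k (@Tmul W) (subst_sum (cR F) P).
Proof.
move=> h hk; rewrite !iter_Tmul_subst.
- apply: functional_extensionality => a; apply: functional_extensionality => b.
  apply: eq_fsum => j; case: (lerP 0 (a + j)) => aj; first by rewrite cLR.
  by rewrite /xshift h ?scaler0 //; lia.
- exact: cR_pascal.
- by apply: (@finsupp_subst_cR _ n0) => q n hn; apply: h; right.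
- exact: cL_pascal.
- exact: finsupp_subst_cL h.
Qed.

Lemma subst_cL_lt0 P a b : a < 0 -> subst_sum (cL F) P a b = 0.
Proof. by move=> a0; apply: fsum0 => j; rewrite /cL cR_lt0 ?scale0r. Qed.

Lemma subst_cR_lt0 P a b : (forall q n, n < 0 -> P q n = 0) ->
  b < 0 -> subst_sum (cR F) P a b = 0.
Proof.
move=> h b0; apply: fsum0 => j; case: (ltrP j 0) => j0; first by rewrite cR_lt0 ?scale0r.
by rewrite h ?scaler0 //; lia.
Qed.

Lemma subst_cR_at0 P a : (forall q n, n < 0 -> P q n = 0) ->
  subst_sum (cR F) P a 0 = P a 0.
Proof.
move=> h; rewrite /subst_sum (@fsum1 _ _ 0) ?cR0 ?scale1r ?addr0 // => j j0.
case: (ltrP j 0) => j1; first by rewrite cR_lt0 ?scale0r.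
by rewrite h ?scaler0 //; lia.
Qed.

(** Since [sgn b * cL b t] is the coefficient of [x^b] in [(1 + x)^(-t-1)], this is the coefficient
    of [x^l] in [(1 + x)^n (1 + x)^(-t-1) = (1 + x)^(n-t-1)], up to the sign of [l]. *)
Lemma alternating_cL (l t : int) (n : nat) :
  \sum_(i < n.+1) 'C(n, i)%:R * (sgn F i * cL F (l - i%:Z) t) = cL F l (t - n%:Z).
Proof.
(* [E] is constant in [a], so multiplication by [x0] acts as 1 and [Tmul] becomes multiplication by
   [1 + x2]. *)
pose E (t a b : int) : F^o := sgn F b * cL F b t.
have ET : iter n (@Tmul F^o) (E t) = E (t - n%:Z).
  elim: n => [|n /= ->]; first by rewrite subr0.
  apply: functional_extensionality => a; apply: functional_extensionality => b.
  rewrite /Tmul /E (cL_pascal F b (t - n%:Z)) (sgnD F b (-1)) {3}/sgn /=.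
  rewrite (_ : t - n%:Z - 1 = t - n.+1%:Z); last by lia.
  by ring.
have := congr1 (fun f => sgn F l * f 0 l) ET; rewrite /= iter_TmulE /E mulrA sgn_sq mul1r.
move=> <-; rewrite mulr_sumr; apply: eq_bigr => i _.
rewrite sgnD sgnN -[_ *: _]/(_ * _ : F).
by rewrite [RHS](_ : _ = (sgn F l * sgn F l) * ('C(n, i)%:R * (sgn F i * cL F (l - i%:Z) t)));
  [rewrite sgn_sq mul1r|ring].
Qed.

(* Substituting [(-x0, x + x0)] for [(x0, x)] in [P(x0 + x, x)] gives [P(x, x + x0)]. *)
Lemma subst_cL_skew P n0 (l t : int) : (forall q n, q < 0 \/ n < n0 -> P q n = 0) ->
  fsum (fun j => (cR F t j * sgn F (l - j)) *: subst_sum (cL F) P (l - j) (t + j)) =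
  subst_sum (cL F) (fun q n => P n q) l t.
Proof.
move=> h.
(* The inner index is shifted by [l - j] so that the argument of [P] no longer depends on [j]. *)
have e1 j : (cR F t j * sgn F (l - j)) *: subst_sum (cL F) P (l - j) (t + j) =
    fsum (fun n => (cR F t j * sgn F (l - j) * cL F (l - j) (n - (l - j))) *: P n (t + l - n)).
  have hf : finsupp (fun i => cL F (l - j) i *: P (l - j + i) (t + j - i)).
    have := finsupp_subst_cL h 0 (l - j) (t + j).
    by case=> N hN; exists N => n /hN; rewrite /xshift subr0.
  rewrite /subst_sum -(fsum_shift (- (l - j)) hf) -fsumZ.
    apply: eq_fsum => n; rewrite scalerA; congr (_ *: P _ _); lia.
  case: hf => N hN; exists (N + absz (l - j))%N => n hn; apply: hN; lia.
rewrite (eq_fsum e1) (@exchange_fsum _ _ 0 l 0 (t + l - n0)); last first.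
  move=> j n hjn.
  case: (ltrP j 0) => j0; first by rewrite cR_lt0 // !mul0r scale0r.
  case: (ltrP (l - j) 0) => j1; first by rewrite /cL [cR _ _ (l - j)]cR_lt0 // mulr0 scale0r.
  by rewrite h ?scaler0 //; case: hjn; lia.
have hf : finsupp (fun i => cL F l i *: P (t - i) (l + i)).
  apply: (@finsupp_itv _ (n0 - l) t) => i hi; rewrite h ?scaler0 //; lia.
rewrite /subst_sum -(fsum_refl t hf); apply: eq_fsum => n.
case: (ltrP n 0) => n0'.
  rewrite [P (t - (t - n)) _]h ?scaler0; last by left; lia.
  by apply: fsum0 => j; rewrite h ?scaler0 //; left.
case: n n0' => // n _.
rewrite subKr (_ : l + (t - n%:Z) = t + l - n%:Z); last by lia.
(* For fixed [n] both sides are multiples of [P n (t + l - n)]. With [j = l - r] the factor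
   [cL r (n - r)] is ['C(n, r)], so the scalars match [alternating_cL]. *)
rewrite -alternating_cL scaler_suml.
have e2 r : (cR F t (l - r) * sgn F (l - (l - r)) * cL F (l - (l - r)) (n%:Z - (l - (l - r))))
    *: P n (t + l - n%:Z) =
    ((if 0 <= r then 'C(n, absz r)%:R else 0) * (sgn F r * cL F (l - r) t)) *: P n (t + l - n%:Z).
  congr (_ *: _); rewrite subKr /cL [cR _ _ r](@cR_nat _ _ _ n); last by lia.
  by rewrite mulrC [cR _ _ _ * _]mulrC.
have hf2 : finsupp (fun j => (cR F t j * sgn F (l - j) * cL F (l - j) (n%:Z - (l - j)))
    *: P n (t + l - n%:Z)).
  apply: (@finsupp_itv _ 0 l) => j [j0|j0]; first by rewrite cR_lt0 // !mul0r scale0r.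
  by rewrite /cL [cR _ _ (l - j)]cR_lt0 ?mulr0 ?scale0r //; lia.
rewrite -(fsum_refl l hf2) (eq_fsum e2).
rewrite (@fsum_seq _ _ [seq i%:Z | i <- iota 0 n.+1]).
- rewrite big_map -[iota 0 n.+1]/(index_iota 0 n.+1) big_mkord.
  by apply: eq_bigr.
- by rewrite map_inj_uniq ?iota_uniq // => i j [].
- move=> r hr; case: ifP => r0; last by rewrite mul0r scale0r.
  case: r r0 hr => // r _ hr; rewrite bin_small ?mul0r ?scale0r //=.
  rewrite ltnNge; apply: contra hr => hr; apply/mapP; exists r => //.
  by rewrite mem_iota.
Qed.

End SubstSum.

(** * Nonlocal vertex algebras *)

Section NonlocalVertexAlgebra.
Variables (F : numFieldType) (V : lmodType F).
Variables (Y : V -> V -> int -> V) (one : V) (hV : is_nva Y one).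

Lemma Yser_linl w m : linmap (fun u => Yser Y u w m).
Proof. by case: hV => /(_ (- m - 1))[hl _] _ _ _ _; apply: hl. Qed.

Lemma Yser_linr u m : linmap (fun w => Yser Y u w m).
Proof. by case: hV => /(_ (- m - 1))[_ hr] _ _ _ _; apply: hr. Qed.

Lemma Yser_trunc u v : exists N : int, forall m, m < N -> Yser Y u v m = 0.
Proof.
case: hV => _ /(_ u v)[N hN] _ _ _; exists (- N) => m hm.
by rewrite /Yser hN //; lia.
Qed.

Lemma Yser_vacl v m : Yser Y one v m = if m == 0 then v else 0.
Proof.
case: hV => _ _ h _ _; rewrite /Yser h.
by rewrite (_ : (- m - 1 == -1) = (m == 0)) //; lia.
Qed.

Lemma Yser_vacr_lt0 v m : m < 0 -> Yser Y v one m = 0.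
Proof. by case: hV => _ _ _ /(_ v)[h _] _ m0; rewrite /Yser h //; lia. Qed.

Lemma Yser_vacr0 v : Yser Y v one 0 = v.
Proof. by case: hV => _ _ _ /(_ v)[_ h] _; rewrite /Yser oppr0 add0r. Qed.

(* Indexed so that [YYser u v w q n] is the coefficient of [x1^q x2^n] in
   [Y(u, x1) Y(v, x2) w]. *)
Definition YYser u v w : int -> int -> V := fun q n => Yser Y u (Yser Y v w n) q.

Lemma weak_assoc u v w : exists k : nat,
  iter k (@Tmul V) (subst_sum (cR F) (YYser u v w)) =
  iter k (@Tmul V) (fun s t => Yser Y (Yser Y u v s) w t).
Proof.
have [N hN] := Yser_trunc v w.
have h0 q n : n < N -> YYser u v w q n = 0.
  by move=> hn; rewrite /YYser hN // (linmap0 (Yser_linr u q)).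
case: hV => _ _ _ _ /(_ u v w)[k hk]; exists k.
rewrite iter_Tmul_subst; [|exact: cR_pascal|exact: (finsupp_subst_cR h0)].
apply: functional_extensionality => a; apply: functional_extensionality => b.
have e (n m n' m' : int) : n = n' -> m = m' ->
  (Y u (Y v w n) m = Y u (Y v w n') m') /\ (Y (Y u v n) w m = Y (Y u v n') w m').
  by move=> -> ->.
rewrite iter_TmulE; transitivity (fsum (fun j : int => if (0 <= j)%R
      then gbin F (a + j) (absz j) *: Y u (Y v w (j - b - 1)) (k%:Z - 1 - j - a) else 0)).
  apply: eq_fsum => j; rewrite /cR; case: ifP => _; last by rewrite scale0r.
  rewrite /xshift /YYser /Yser; congr (_ *: _).
  by have [] := e (- (b - j) - 1) (- (a + j - k%:Z) - 1) (j - b - 1) (k%:Z - 1 - j - a)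
    ltac:(lia) ltac:(lia).
rewrite hk; apply: eq_bigr => i _; rewrite /Yser; congr (_ *: _).
by have [] := e (k%:Z - i%:Z - a - 1) (i%:Z - b - 1)
    (- (a - k%:Z + i%:Z) - 1) (- (b - i%:Z) - 1) ltac:(lia) ltac:(lia).
Qed.

(** The bound [q0] allows the expansion of [(x0 + x2)^q] to be switched from [cR] to [cL]. Then
    neither side has negative powers of [x0], and [x0 + x2] cancels. *)
Lemma assoc_regular u v w q0 :
  (forall s, s < 0 -> Yser Y u v s = 0) ->
  (forall q n, q < q0 -> YYser u v w q n = 0) ->
  forall s t, Yser Y (Yser Y u v s) w t = subst_sum (cL F) (YYser u v w) s t.
Proof.
move=> hreg hq; have [N hN] := Yser_trunc v w.
have h q n : q < q0 \/ n < N -> YYser u v w q n = 0.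
  case=> [|hn]; first exact: hq.
  by rewrite /YYser hN // (linmap0 (Yser_linr u q)).
have [k hk] := weak_assoc u v w.
(* [absz q0] factors clear the poles in [x1]; the other [k] come from weak associativity. *)
apply: (@iter_Tmul_injl _ (absz q0 + k)).
- by move=> s t s0; rewrite hreg // (linmap0 (Yser_linl w t)).
- by move=> s t; apply: subst_cL_lt0.
rewrite (iter_Tmul_cLR h) ?leq_addr //.
by rewrite !iterD -hk.
Qed.

Lemma assoc_mode0 u v w :
  (forall t, t < 0 -> Yser Y v w t = 0) ->
  (forall s t, t < 0 -> Yser Y (Yser Y u v s) w t = 0) ->
  forall s, Yser Y u (Yser Y v w 0) s = Yser Y (Yser Y u v s) w 0.
Proof.
move=> hreg hreg2 s; have [k hk] := weak_assoc u v w.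
have h0 q n : n < 0 -> YYser u v w q n = 0.
  by move=> hn; rewrite /YYser hreg // (linmap0 (Yser_linr u q)).
rewrite -[LHS](subst_cR_at0 (P := YYser u v w) s h0).
apply: (iter_Tmul_injr _ _ hk s 0) => // a b.
exact: subst_cR_lt0.
Qed.

(** Taking the vacuum as second vector, [assoc_regular] reads [Y(Y(u, x0)1, x)w = Y(u, x + x0)w];
    this is its coefficient of [x0^1]. *)
Lemma Yser_D u w t : Yser Y (Dop Y one u) w t = (t + 1)%:~R *: Yser Y u w (t + 1).
Proof.
have [N hN] := Yser_trunc u w.
have hP q n : YYser u one w q n = if n == 0 then Yser Y u w q else 0.
  by rewrite /YYser Yser_vacl; case: ifP => // _; rewrite (linmap0 (Yser_linr u q)).
rewrite -[Dop Y one u]/(Yser Y u one 1) (@assoc_regular u one w N).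
- rewrite /subst_sum (@fsum1 _ _ t) => [|j jt].
    rewrite hP subrr /= addrC; congr (_ *: _).
    by rewrite /cL /cR /= /gbin big_ord1 subr0 divr1.
  by rewrite hP subr_eq0 eq_sym (negPf jt) scaler0.
- exact: Yser_vacr_lt0.
- by move=> q n hq; rewrite hP hN //; case: ifP.
Qed.

(** Divided by [j!], this is the coefficient of [x0^j] in [Y(e^{x0 D} u, x)w = Y(u, x + x0)w]. *)
Lemma Yser_iterD j u w t :
  Yser Y (iter j (Dop Y one) u) w t = (j`!%:R * cR F t j) *: Yser Y u w (t + j%:Z).
Proof.
elim: j t => [|j IH] t; first by rewrite cR0 mulr1 scale1r addr0.
rewrite iterS Yser_D IH scalerA -!addrA; congr (_ *: _).
have fg (p : int) (i : nat) : i`!%:R * gbin F p i = \prod_(l < i) (p - l%:Z)%:~R.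
  by rewrite mulrC divfK // pnatr_eq0 -lt0n fact_gt0.
rewrite /cR /= !fg [RHS]big_ord_recr /= mulrC; congr (_ * _%:~R); last by lia.
apply: eq_bigr => i _; congr (_%:~R); lia.
Qed.

End NonlocalVertexAlgebra.

(** * Sums and uniform bounds over the finite lists that represent [R(x)] *)

Section ListBounds.
Variable I : Type.
Implicit Types s : seq I.

Lemma eq_big_In (W : nmodType) s (f g : I -> W) :
  (forall t, List.In t s -> f t = g t) -> \sum_(t <- s) f t = \sum_(t <- s) g t.
Proof.
elim: s => [|t s IH] h; rewrite ?big_nil // !big_cons h; last by left.
by congr (_ + _); apply: IH => x hx; apply: h; right.
Qed.

Lemma big1_In (W : nmodType) s (f : I -> W) :
  (forall t, List.In t s -> f t = 0) -> \sum_(t <- s) f t = 0.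
Proof. by move=> h; rewrite (eq_big_In h) big1. Qed.

Lemma uniform_trunc s (h : I -> int -> Prop) :
  (forall t, List.In t s -> exists N : int, forall n, n < N -> h t n) ->
  exists N : int, forall t, List.In t s -> forall n, n < N -> h t n.
Proof.
elim: s => [|x s IH] hs; first by exists 0.
have [N1 h1] := IH (fun t ht => hs t (or_intror ht)).
have [N2 h2] := hs x (or_introl erefl).
exists (if N1 <= N2 then N1 else N2) => t [<-|ht] n hn.
  by apply: h2; case: ifP hn; lia.
by apply: h1 => //; case: ifP hn; lia.
Qed.
End ListBounds.

Section Convolution.
Variables (F : numFieldType) (W : lmodType F).

(** Multiplication by a scalar series [g(x0)] commutes with multiplication by [x0 + x2]. *)
Lemma iter_Tmul_conv (g : int -> F) (E : int -> int -> W) k :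
  (forall a b, finsupp (fun p => g p *: E (a - p) b)) ->
  forall a b, iter k (@Tmul W) (fun x y => fsum (fun p => g p *: E (x - p) y)) a b =
  fsum (fun p => g p *: iter k (@Tmul W) E (a - p) b).
Proof.
move=> hf a b.
suff [] : (forall a b, finsupp (fun p => g p *: iter k (@Tmul W) E (a - p) b)) /\
  (forall a b, iter k (@Tmul W) (fun x y => fsum (fun p => g p *: E (x - p) y)) a b =
    fsum (fun p => g p *: iter k (@Tmul W) E (a - p) b)) by [].
elim: k {a b} => [|k [IHf IH]] //.
have e a b p : g p *: iter k.+1 (@Tmul W) E (a - p) b =
    g p *: iter k (@Tmul W) E (a - 1 - p) b + g p *: iter k (@Tmul W) E (a - p) (b - 1).
  by rewrite iterS /Tmul scalerDr (_ : a - p - 1 = a - 1 - p) //; lia.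
split=> a b.
  have [N1 h1] := IHf (a - 1) b; have [N2 h2] := IHf a (b - 1).
  by exists (maxn N1 N2) => n hn; rewrite e h1 ?h2 ?addr0 //; lia.
by rewrite iterS {1}/Tmul !IH -fsumD //; apply: eq_fsum => p; rewrite e.
Qed.

Lemma iter_Tmul_sum (I : Type) (s : seq I) (E : I -> int -> int -> W) k a b :
  iter k (@Tmul W) (fun x y => \sum_(t <- s) E t x y) a b =
  \sum_(t <- s) iter k (@Tmul W) (E t) a b.
Proof.
elim: k a b => //= k IH a b; rewrite {1}/Tmul !IH -big_split.
by apply: eq_bigr.
Qed.
End Convolution.

(** * The universal property *)

Section Universal.
Variables (F : numFieldType) (U V K : lmodType F).
Variables (YU : U -> U -> int -> U) (oneU : U) (YV : V -> V -> int -> V) (oneV : V).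
Variables (YK : K -> K -> int -> K) (oneK : K).
Hypotheses (hU : is_nva YU oneU) (hV : is_nva YV oneV) (hK : is_nva YK oneK).
Variable (Rt : V -> U -> seq (U * V * (int -> F))).
Hypothesis hR : is_twisting YU oneU YV oneV Rt.
Variables (psi1 : U -> K) (psi2 : V -> K).
Hypotheses (h1 : is_nva_hom YU oneU YK oneK psi1) (h2 : is_nva_hom YV oneV YK oneK psi2).
Hypothesis hpos : forall u v n, 0 <= n -> YK (psi1 u) (psi2 v) n = 0.
Hypothesis hcomm : forall u v,
     Yser YK (psi2 v) (psi1 u)
     = expD (Dop YK oneK)
         (fun m => \sum_(t <- Rt v u)
                     smul (fun p => sgn F p * t.2 p) (sneg (Yser YK (psi1 t.1.1) (psi2 t.1.2))) m).

Let psi (u : U) (v : V) : K := Yser YK (psi1 u) (psi2 v) 0.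

Lemma Yser_psi1 u u' m : psi1 (Yser YU u u' m) = Yser YK (psi1 u) (psi1 u') m.
Proof. by case: h1 => _ _ h; rewrite /Yser h. Qed.

Lemma Yser_psi2 v v' m : psi2 (Yser YV v v' m) = Yser YK (psi2 v) (psi2 v') m.
Proof. by case: h2 => _ _ h; rewrite /Yser h. Qed.

Lemma psi12_regular u v m : m < 0 -> Yser YK (psi1 u) (psi2 v) m = 0.
Proof. by move=> m0; apply: hpos; lia. Qed.

Lemma psi_bilin : bilin psi.
Proof.
case: h1 h2 => l1 _ _ [l2 _ _]; split=> [v|u] a x y.
  by rewrite /psi l1 (Yser_linl hK).
by rewrite /psi l2 (Yser_linr hK).
Qed.

(** The coefficients of [Y(psi1 u, x0) psi1 u'] lie in the image of [psi1], so both regularity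
    conditions of [assoc_mode0] follow from [hpos]. *)
Lemma Yser_psi1_psi u u' v' m :
  Yser YK (psi1 u) (psi u' v') m = psi (Yser YU u u' m) v'.
Proof.
rewrite /psi Yser_psi1; apply: (assoc_mode0 hK) => [t|s t]; first exact: psi12_regular.
by rewrite -Yser_psi1; apply: psi12_regular.
Qed.

Lemma Rt_trunc v u : exists p0 : int, forall t, List.In t (Rt v u) ->
  forall n, n < p0 -> t.2 n = 0.
Proof. by apply: uniform_trunc; case: hR => h _ t; apply: h. Qed.

Let Pt v' (t : U * V * (int -> F)) := YYser YK (psi1 t.1.1) (psi2 t.1.2) (psi2 v').

(** There are no negative powers of [x1] because [Y(psi2 v_i, x2) psi2 v'] has coefficients in the
    image of [psi2], on which [psi1] acts regularly. *)
Lemma Pt_trunc v u v' : exists n0 : int, forall t, List.In t (Rt v u) ->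
  forall q n, q < 0 \/ n < n0 -> Pt v' t q n = 0.
Proof.
have [n0 h0] : exists n0 : int, forall t, List.In t (Rt v u) ->
    forall n, n < n0 -> Yser YK (psi2 t.1.2) (psi2 v') n = 0.
  by apply: uniform_trunc => t _; apply: (Yser_trunc hK).
exists n0 => t /h0 {}h0 q n [q0|n1]; rewrite /Pt /YYser.
  by rewrite -Yser_psi2 psi12_regular.
by rewrite h0 // (linmap0 (Yser_linr hK _ q)).
Qed.

(* [\sum_i f_i(-x0) P_i(x, x + x0)], powers of [x + x0] being expanded according to [c]. *)
Let Scoef v u v' (c : int -> int -> F) (a b : int) : K :=
  \sum_(t <- Rt v u) fsum (fun p => (sgn F p * t.2 p) *:
     subst_sum c (fun q n => Pt v' t n q) (a - p) b).

Lemma Yser_skew v u v' s t' :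
  Yser YK (Yser YK (psi2 v) (psi1 u) s) (psi2 v') t' = Scoef v u v' (cL F) s t'.
Proof.
have [p0 hp0] := Rt_trunc v u; have [n0 hn0] := Pt_trunc v u v'.
pose G (m : int) := \sum_(t <- Rt v u)
  smul (fun p => sgn F p * t.2 p) (sneg (Yser YK (psi1 t.1.1) (psi2 t.1.2))) m.
rewrite hcomm -/G /expD.
have G0 m : m < p0 -> G m = 0.
  move=> hm; apply: big1_In => t /hp0 ht; apply: fsum0 => p; rewrite /sneg.
  case: (ltrP p p0) => hp; first by rewrite ht // mulr0 scale0r.
  by rewrite psi12_regular ?scaler0 //; lia.
rewrite (linmap_fsum (Yser_linl hK _ _)); last first.
  apply: (@finsupp_itv _ 0 (s - p0)) => j [j0|j0]; case: ifP => // j1; first by lia.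
  rewrite G0; last by lia.
  rewrite (_ : iter _ _ 0 = 0) ?scaler0 //; elim: (absz j) => //= n ->.
  exact: (linmap0 (Yser_linl hK oneK 1)).
have eG m x : Yser YK (G m) (psi2 v') x = \sum_(t <- Rt v u) fsum (fun p =>
   (sgn F p * t.2 p * sgn F (m - p)) *: subst_sum (cL F) (Pt v' t) (m - p) x).
  rewrite (linmap_sum (Yser_linl hK _ _)); apply: eq_big_In => t ht.
  rewrite /smul (linmap_fsum (Yser_linl hK _ _)); last first.
    apply: (@finsupp_itv _ p0 m) => p [hp|hp]; rewrite /sneg.
      by rewrite (hp0 _ ht) // mulr0 scale0r.
    by rewrite psi12_regular ?scaler0 //; lia.
  apply: eq_fsum => p; rewrite /sneg scalerA (linmapZ (Yser_linl hK _ _)).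
  congr (_ *: _); apply: (assoc_regular hK (q0 := 0)) => [y|q n]; first exact: psi12_regular.
  by move=> q0; apply: (hn0 _ ht); left.
(* The factorial of [e^{x D}] cancels the one in [Yser_iterD], leaving the coefficient [cR t' j]. *)
have eJ j : Yser YK (if 0 <= j then (absz j)`!%:R^-1 *: iter (absz j) (Dop YK oneK) (G (s - j))
     else 0) (psi2 v') t' = \sum_(t <- Rt v u) fsum (fun p => cR F t' j *: (
   (sgn F p * t.2 p * sgn F (s - j - p)) *: subst_sum (cL F) (Pt v' t) (s - j - p) (t' + j))).
  case: ifP => j0; last first.
    rewrite (linmap0 (Yser_linl hK _ _)) big1 // => t _; apply: fsum0 => p.
    by rewrite cR_lt0 ?scale0r //; lia.
  rewrite (linmapZ (Yser_linl hK _ _)) (Yser_iterD hK) scalerA mulKf; last first.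
    by rewrite pnatr_eq0 -lt0n fact_gt0.
  rewrite (_ : (absz j)%:Z = j) ?eG ?scaler_sumr; last by lia.
  apply: eq_big_In => t ht; rewrite fsumZ //.
  apply: (@finsupp_itv _ p0 (s - j)) => p [hp|hp].
    by rewrite (hp0 _ ht) // mulr0 mul0r scale0r.
  by rewrite subst_cL_lt0 ?scaler0 //; lia.
rewrite (eq_fsum eJ).
have hX t : List.In t (Rt v u) -> forall j p,
  [\/ j < 0, s - p0 < j, p < p0 | s < p] ->
  cR F t' j *: ((sgn F p * t.2 p * sgn F (s - j - p)) *:
    subst_sum (cL F) (Pt v' t) (s - j - p) (t' + j)) = 0.
  move=> ht j p hjp.
  case: (ltrP j 0) => j0; first by rewrite cR_lt0 ?scale0r.
  case: (ltrP p p0) => hp; first by rewrite (hp0 _ ht) // mulr0 mul0r scale0r scaler0.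
  by rewrite subst_cL_lt0 ?scaler0 //; case: hjp; lia.
have [_ ->] := fsum_sum (fun t ht => finsupp_itv (lo := 0) (hi := s - p0)
  (fun j hj => fsum0 (fun p => hX t ht j p (match hj with
     or_introl h => Or41 _ _ _ h | or_intror h => Or42 _ _ _ h end)))).
apply: eq_big_In => t ht.
(* For fixed [p], the sum over [j] is the one in [subst_cL_skew] with [l = s - p]. *)
rewrite (exchange_fsum (hX t ht)); apply: eq_fsum => p.
rewrite -(subst_cL_skew _ _ (hn0 _ ht)) -fsumZ.
  apply: eq_fsum => j; rewrite !scalerA addrAC.
  by congr (_ *: _); ring.
apply: (@finsupp_itv _ 0 (s - p)) => j [j0|j0]; first by rewrite cR_lt0 // mul0r scale0r.
by rewrite subst_cL_lt0 ?scaler0 //; lia.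
Qed.

Lemma Yser_psi2_psi v u' v' m :
  Yser YK (psi2 v) (psi u' v') m =
  \sum_(t <- Rt v u') fsum (fun p => (sgn F p * t.2 p) *: psi t.1.1 (Yser YV t.1.2 v' (m - p))).
Proof.
have [p0 hp0] := Rt_trunc v u'; have [n0 hn0] := Pt_trunc v u' v'.
pose Q := YYser YK (psi2 v) (psi1 u') (psi2 v').
have hQ q n : n < 0 -> Q q n = 0.
  by move=> hn; rewrite /Q /YYser psi12_regular // (linmap0 (Yser_linr hK _ q)).
have hR0 t : List.In t (Rt v u') -> forall q n, n < 0 -> Pt v' t n q = 0.
  by move=> ht q n hn; apply: (hn0 _ ht); left.
(* The variable [x2] of [Pt] is replaced by [x0 + x], so [absz n0] factors clear its poles for all
   terms at once. *)
have e : iter (absz n0) (@Tmul K) (Scoef v u' v' (cL F)) =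
         iter (absz n0) (@Tmul K) (Scoef v u' v' (cR F)).
  apply: functional_extensionality => a; apply: functional_extensionality => b.
  rewrite !iter_Tmul_sum; apply: eq_big_In => t ht.
  rewrite !iter_Tmul_conv.
  - apply: eq_fsum => p; congr (_ *: _).
    rewrite (iter_Tmul_cLR (q0 := n0) (n0 := 0)) // => q n hqn; apply: (hn0 _ ht); lia.
  - move=> x y; apply: (@finsupp_itv _ p0 (x + y - n0)) => p [hp|hp].
      by rewrite (hp0 _ ht) // mulr0 scale0r.
    rewrite (_ : subst_sum _ _ _ _ = 0) ?scaler0 //; apply: fsum0 => j.
    case: (ltrP j 0) => j0; first by rewrite cR_lt0 ?scale0r.
    by rewrite (hn0 _ ht) ?scaler0 //; lia.
  - move=> x y; apply: (@finsupp_itv _ p0 x) => p [hp|hp].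
      by rewrite (hp0 _ ht) // mulr0 scale0r.
    by rewrite subst_cL_lt0 ?scaler0 //; lia.
have [k hk] := weak_assoc hK (psi2 v) (psi1 u') (psi2 v').
have eH : (fun s t => Yser YK (Yser YK (psi2 v) (psi1 u') s) (psi2 v') t) =
    Scoef v u' v' (cL F).
  apply: functional_extensionality => a; apply: functional_extensionality => b.
  exact: Yser_skew.
have : subst_sum (cR F) Q m 0 = Scoef v u' v' (cR F) m 0.
  (* Neither side has negative powers of the second variable: [Q] by regularity of [psi1 u'] on
     [psi2 v'], the sum because each [Pt] is regular in [x1]. *)
  apply: (@iter_Tmul_injr _ (absz n0 + k)).
  - by move=> a b; apply: subst_cR_lt0.
  - move=> a b b0; apply: big1_In => t ht; apply: fsum0 => p.
    by rewrite subst_cR_lt0 ?scaler0 // => q n; apply: hR0.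
  - by rewrite iterD hk eH -iterD addnC iterD e -iterD addnC.
rewrite subst_cR_at0 // {1}/Q /YYser => ->; apply: eq_big_In => t ht.
apply: eq_fsum => p; congr (_ *: _); rewrite subst_cR_at0; last exact: hR0.
by rewrite /Pt /YYser /psi Yser_psi2.
Qed.

Lemma psi_hom u v u' v' m :
  twY YU YV Rt psi u v u' v' m = Yser YK (psi u v) (psi u' v') m.
Proof.
have [p0 hp0] := Rt_trunc v u'.
have [n0 hn0] : exists n0 : int, forall t, List.In t (Rt v u') ->
    forall n, n < n0 -> Yser YV t.1.2 v' n = 0.
  by apply: uniform_trunc => t _; apply: (Yser_trunc hV).
have [q0 hq0] : exists q0 : int, forall t, List.In t (Rt v u') ->
    forall q, q < q0 -> Yser YU u t.1.1 q = 0.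
  by apply: uniform_trunc => t _; apply: (Yser_trunc hU).
have [psil psir] := psi_bilin.
pose X t p q n := (sgn F p * t.2 p) *: psi (Yser YU u t.1.1 q) (Yser YV t.1.2 v' n).
have X0 t p q n : List.In t (Rt v u') -> [\/ p < p0, q < q0 | n < n0] -> X t p q n = 0.
  rewrite /X => ht [hp|hq|hn].
  - by rewrite (hp0 _ ht) // mulr0 scale0r.
  - by rewrite (hq0 _ ht) // (linmap0 (psil _)) scaler0.
  - by rewrite (hn0 _ ht) // (linmap0 (psir _)) scaler0.
have eY q n : YYser YK (psi1 u) (psi2 v) (psi u' v') q n =
    \sum_(t <- Rt v u') fsum (fun p => X t p q (n - p)).
  rewrite /YYser Yser_psi2_psi (linmap_sum (Yser_linr hK _ _)); apply: eq_big_In => t ht.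
  rewrite (linmap_fsum (Yser_linr hK _ _)); last first.
    apply: (@finsupp_itv _ p0 (n - n0)) => p [hp|hp].
      by rewrite (hp0 _ ht) // mulr0 scale0r.
    by rewrite (hn0 _ ht) ?(linmap0 (psir _)) ?scaler0 //; lia.
  by apply: eq_fsum => p; rewrite (linmapZ (Yser_linr hK _ _)) Yser_psi1_psi.
(* [psi u v] is the coefficient of [x0^0], where [cL 0 j = 1], so the right side becomes the
   diagonal of [Y(psi1 u, x1) Y(psi2 v, x2) psi(u', v')]. By [eY] its poles in [x1] are bounded by
   those of the [Y(u, x1) u'_i]. *)
rewrite {2}/psi (assoc_regular hK (q0 := q0)); first last.
- move=> q n hq; rewrite eY; apply: big1_In => t ht; apply: fsum0 => p.
  by apply: X0 => //; apply: Or32.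
- by move=> s; apply: psi12_regular.
rewrite /twY /subst_sum.
have eT j : cL F 0 j *: YYser YK (psi1 u) (psi2 v) (psi u' v') (0 + j) (m - j) =
    \sum_(t <- Rt v u') fsum (fun p => X t p j (m - j - p)).
  by rewrite /cL cR0 scale1r add0r eY.
have hX t : List.In t (Rt v u') -> forall j p,
    [\/ j < q0, m - p0 - n0 < j, p < p0 | m - q0 - n0 < p] -> X t p j (m - j - p) = 0.
  move=> ht j p hjp; apply: X0 => //.
  case: (ltrP p p0) => hp; first exact: Or31.
  case: (ltrP j q0) => hj; first exact: Or32.
  by apply: Or33; case: hjp; lia.
rewrite (eq_fsum eT).
have [_ ->] := fsum_sum (fun t ht => finsupp_itv (lo := q0) (hi := m - p0 - n0)
  (fun j hj => fsum0 (fun p => hX t ht j p (match hj with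
     or_introl h => Or41 _ _ _ h | or_intror h => Or42 _ _ _ h end)))).
apply: eq_big_In => t ht.
rewrite (exchange_fsum (hX t ht)); apply: eq_fsum => p.
rewrite -fsumZ; first by apply: eq_fsum => r; rewrite /X addrAC.
apply: (@finsupp_itv _ q0 (m - p - n0)) => r [hr|hr].
  by rewrite (hq0 _ ht) // (linmap0 (psil _)).
by rewrite (hn0 _ ht) ?(linmap0 (psir _)) //; lia.
Qed.

Lemma psi_vacr u : psi u oneV = psi1 u.
Proof. by case: h2 => _ e _; rewrite /psi e (Yser_vacr0 hK). Qed.

Lemma psi_vacl v : psi oneU v = psi2 v.
Proof. by case: h1 => _ e _; rewrite /psi e (Yser_vacl hK) eqxx. Qed.

(** [R(x)(1 (x) 1) = 1 (x) 1] is available only through bilinear test maps, so the inner sum is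
    packaged for each [p] as the bilinear map [B p]. Only [B 0 oneU oneV] survives, and in it only
    the term [r = 0]. *)
Lemma twY_vac (phi : U -> V -> K) u v : bilin phi ->
  twY YU YV Rt phi u oneV oneU v 0 = phi u v.
Proof.
move=> [phil phir].
have [p0 hp0] := Rt_trunc oneV oneU.
pose B p x y := fsum (fun r => phi (Yser YU u x r) (Yser YV y v (0 - p - r))).
have Bfin p x y : finsupp (fun r => phi (Yser YU u x r) (Yser YV y v (0 - p - r))).
  have [q0 hq0] := Yser_trunc hU u x; have [n0 hn0] := Yser_trunc hV y v.
  apply: (@finsupp_itv _ q0 (0 - p - n0)) => r [hr|hr].
    by rewrite hq0 // (linmap0 (phil _)).
  by rewrite hn0 ?(linmap0 (phir _)) //; lia.
have Bbil p : bilin (B p).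
  split=> [y|x] a z z'; rewrite /B -fsumZ // -fsumD //.
  - by apply: eq_fsum => r; rewrite (Yser_linr hU) phil.
  - by have [N hN] := Bfin p z y; exists N => n hn; rewrite hN ?scaler0.
  - by apply: eq_fsum => r; rewrite (Yser_linl hV) phir.
  - by have [N hN] := Bfin p x z; exists N => n hn; rewrite hN ?scaler0.
have hf t : List.In t (Rt oneV oneU) ->
    finsupp (fun p => (sgn F p * t.2 p) *: B p t.1.1 t.1.2).
  move=> ht; have [q0 hq0] := Yser_trunc hU u t.1.1.
  have [n0 hn0] := Yser_trunc hV t.1.2 v.
  apply: (@finsupp_itv _ p0 (0 - q0 - n0)) => p [hp|hp].
    by rewrite (hp0 _ ht) // mulr0 scale0r.
  rewrite /B fsum0 ?scaler0 // => r; case: (ltrP r q0) => hr.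
    by rewrite hq0 // (linmap0 (phil _)).
  by rewrite hn0 ?(linmap0 (phir _)) //; lia.
have [_ e] := fsum_sum hf; rewrite /twY -e {e}.
have eB p : \sum_(t <- Rt oneV oneU) (sgn F p * t.2 p) *: B p t.1.1 t.1.2 =
    sgn F p *: (if p == 0 then B p oneU oneV else 0).
  case: hR => _ /(_ _ _ (Bbil p))[_ _ <- _ _]; rewrite /ev scaler_sumr.
  by apply: eq_bigr => t _; rewrite scalerA.
rewrite (eq_fsum eB) (@fsum1 _ _ 0) => [|p /negPf ->]; last by rewrite scaler0.
rewrite eqxx scale1r /B (@fsum1 _ _ 0) => [|r r0].
  by rewrite (Yser_vacr0 hU) (Yser_vacl hV) eqxx.
by rewrite (Yser_vacl hV) ifF ?(linmap0 (phir _)) //; lia.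
Qed.

Lemma psi_unique (phi : U -> V -> K) :
  is_tt_hom YU oneU YV oneV Rt YK oneK phi ->
  (forall u, phi u oneV = psi1 u) -> (forall v, phi oneU v = psi2 v) ->
  forall u v, phi u v = psi u v.
Proof.
move=> [phib _ phih] e1 e2 u v.
by rewrite /psi -e1 -e2 -phih twY_vac.
Qed.

End Universal.

Theorem theorem2p7 (R : realType)
  (U V K : lmodType (Cx R))
  (YU : U -> U -> int -> U) (oneU : U) (YV : V -> V -> int -> V) (oneV : V)
  (YK : K -> K -> int -> K) (oneK : K)
  (hU : is_nva YU oneU) (hV : is_nva YV oneV) (hK : is_nva YK oneK)
  (Rt : V -> U -> seq (U * V * (int -> Cx R)))
  (hR : is_twisting YU oneU YV oneV Rt)
  (psi1 : U -> K) (psi2 : V -> K)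
  (h1 : is_nva_hom YU oneU YK oneK psi1) (h2 : is_nva_hom YV oneV YK oneK psi2)
  (hpos : forall u v n, 0 <= n -> YK (psi1 u) (psi2 v) n = 0)
  (hcomm : forall u v,
     Yser YK (psi2 v) (psi1 u)
     = expD (Dop YK oneK)
         (fun m => \sum_(t <- Rt v u)
                     smul (sneg t.2) (sneg (Yser YK (psi1 t.1.1) (psi2 t.1.2))) m)) :
  let psi := fun (u : U) (v : V) => YK (psi1 u) (psi2 v) (-1) in
  [/\ is_tt_hom YU oneU YV oneV Rt YK oneK psi,
      (forall u, psi u oneV = psi1 u),
      (forall v, psi oneU v = psi2 v) &
      (forall phi : U -> V -> K,
         is_tt_hom YU oneU YV oneV Rt YK oneK phi ->
         (forall u, phi u oneV = psi1 u) -> (forall v, phi oneU v = psi2 v) ->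
         forall u v, phi u v = psi u v)].
Proof.
split.
- split; first exact: (psi_bilin hK h1 h2).
    rewrite -[LHS]/(Yser YK (psi1 oneU) (psi2 oneV) 0) (psi_vacr hK psi1 h2).
    by case: h1.
  (* [sneg t.2] is convertible with [fun p => sgn p * t.2 p], and the mode -1 with the coefficient
     [Yser] at 0. *)
  exact: (psi_hom hU hV hK hR h1 h2 hpos hcomm).
- exact: (psi_vacr hK psi1 h2).
- exact: (psi_vacl hK psi2 h1).
- exact: (psi_unique hU hV hR).
Qed.
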